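(* For every integer $n\geq 2$, the number of spanning quasi-trees of the bouquet $\mathbb{F}'_n$ equals the $(n-1)$-th Lucas number: $\kappa(\mathbb{F}'_n)=\ell_{n-1}$.
   Context: A ribbon graph is a surface with boundary made of vertex discs and edge ribbons; each edge ribbon meets vertex discs in exactly two disjoint arcs, each lying on the boundary of exactly one vertex and one edge. A bouquet is a ribbon graph with exactly one vertex, so all edges are loops; a loop is non-orientable if together with the vertex it forms a Möbius band, and orientable otherwise. For $F\subseteq E(G)$, the spanning ribbon subgraph $(V(G),F)$ is obtained by deleting the edges outside $F$. A quasi-tree is a ribbon graph with exactly one boundary component, and $\kappa(G)$ is the number of sets $F\subseteq E(G)$ such that $(V(G),F)$ is a quasi-tree. A bouquet with edges $1,\dots,n$ is described by a signed rotation: a cyclic sequence in which each label $i$ occurs twice, recording the order in which the two ends of the edges meet the boundary of the vertex; an occurrence may carry a minus sign (a plus sign is omitted), and edge $i$ is an orientable loop iff its two occurrences have the same sign. The bouquet $\mathbb{F}'_2$ has signed rotation $(1,2,2,1)$; for $n\geq 3$, $\mathbb{F}'_n$ has signed rotation consisting of $1,2,3,2,1$, followed by $i,i-1$ for $i=4,\dots,n$, followed by $n$, i.e. $(1,2,3,2,1,4,3,5,4,\dots,n,n-1,n)$ (all loops orientable). Lucas numbers: $\ell_1=1$, $\ell_2=3$, $\ell_k=\ell_{k-1}+\ell_{k-2}$. *)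

(* Defs.v *)
From HB Require Import structures.
From mathcomp Require Import all_boot finmap zify.

Set Implicit Arguments.
Unset Strict Implicit.
Unset Printing Implicit Defensive.

Local Open Scope fset_scope.
Local Open Scope nat_scope.

(* Ribbon graphs with one vertex are presented by their signed rotation, read
   cyclically.  An occurrence (e, s) is an end of the edge labelled e, and
   s = true stands for a minus sign. *)
Definition is_signed_rotation (w : seq (nat * bool)) : bool :=
  all (fun e => count_mem e (unzip1 w) == 2) (unzip1 w).

Record bouquet := Bouquet {
  rotation : seq (nat * bool);
  rotationP : is_signed_rotation rotation }.

Definition edges (B : bouquet) : {fset nat} :=
  [fset e in unzip1 (rotation B)].

Definition restrict_rotation (w : seq (nat * bool)) (F : {fset nat}) :=
  [seq x <- w | x.1 \in F].

Lemma restrict_rotationP w F :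
  is_signed_rotation w -> is_signed_rotation (restrict_rotation w F).
Proof.
move=> /allP hw; apply/allP => e.
have -> : unzip1 (restrict_rotation w F) = [seq i <- unzip1 w | i \in F].
  by rewrite /unzip1 filter_map.
rewrite mem_filter => /andP[eF ew]; rewrite count_filter -(eqP (hw e ew)).
apply/eqP/eq_count => i /=.
by case: eqP => // ->; rewrite eF.
Qed.

Definition spanning_subgraph (B : bouquet) (F : {fset nat}) : bouquet :=
  Bouquet (restrict_rotationP F (rotationP B)).

Definition label (w : seq (nat * bool)) (i : 'I_(size w)) : nat := (tnth (in_tuple w) i).1.
Definition sign (w : seq (nat * bool)) (i : 'I_(size w)) : bool := (tnth (in_tuple w) i).2.

(* The i-th edge end is glued along an arc of the vertex boundary.  With that
   boundary circle oriented in the order of the rotation, (i, false) is the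
   initial and (i, true) the final endpoint of this arc.  The boundary of the
   ribbon graph is made of the following segments joining such points. *)
Definition corner (w : seq (nat * bool)) : finType := ('I_(size w) * bool)%type.

Definition vertex_segment (w : seq (nat * bool)) (x y : corner w) : bool :=
  [&& x.2, ~~ y.2 & y.1 == ordS x.1].

(* The two sides of the ribbon of an orientable loop join initial to final
   endpoints; those of a non-orientable loop, because of the half-twist, join
   initial to initial and final to final endpoints. *)
Definition ribbon_side (w : seq (nat * bool)) (x y : corner w) : bool :=
  [&& x.1 != y.1, label x.1 == label y.1 &
      if sign x.1 == sign y.1 then x.2 != y.2 else x.2 == y.2].

Definition boundary_adj (w : seq (nat * bool)) : rel (corner w) := fun x y =>
  [|| vertex_segment x y, vertex_segment y x | ribbon_side x y].

(* Without edges there are no corners, and the boundary is the single circle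
   bounding the vertex disc. *)
Definition boundary_components (w : seq (nat * bool)) : nat :=
  if nilp w then 1 else n_comp (@boundary_adj w) predT.

Definition quasi_tree (B : bouquet) : bool :=
  boundary_components (rotation B) == 1.

Definition kappa (B : bouquet) : nat :=
  #|` [fset F in fpowerset (edges B) | quasi_tree (spanning_subgraph B F)] |.

(* The labels of the rotation of F'_n; meaningful for n >= 2 only. *)
Definition Fprime_labels (n : nat) : seq nat :=
  if n <= 1 then [::]
  else if n == 2 then [:: 1; 2; 2; 1]
  else [:: 1; 2; 3; 2; 1] ++ flatten [seq [:: i; i.-1] | i <- iota 4 (n - 3)]
       ++ [:: n].

Definition Fprime_rotation (n : nat) : seq (nat * bool) :=
  [seq (i, false) | i <- Fprime_labels n].

Lemma count_Fprime_tail e k :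
  count_mem e (flatten [seq [:: i; i.-1] | i <- iota 4 k] ++ [:: k + 3])
  = (e == 3) + 2 * (4 <= e < k + 4).
Proof.
elim: k => [|k IHk]; first by rewrite /=; lia.
move: IHk; rewrite -[k.+1]addn1 iotaD map_cat flatten_cat !count_cat /=; lia.
Qed.

Lemma count_Fprime_labels n e :
  1 < n -> count_mem e (Fprime_labels n) = 2 * (0 < e <= n).
Proof.
rewrite /Fprime_labels; case: n => [|[|[|n]]] // _; first by rewrite /=; lia.
have := count_Fprime_tail e n.
have -> : n.+3 - 3 = n by lia.
rewrite !count_cat /= -[n.+3]addn3; lia.
Qed.

Lemma Fprime_rotationP n : is_signed_rotation (Fprime_rotation n).
Proof.
rewrite /is_signed_rotation /Fprime_rotation /unzip1 -map_comp map_id.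
have [n2|n1] := ltnP 1 n; last by rewrite /Fprime_labels n1.
apply/allP => e; rewrite -has_pred1 has_count count_Fprime_labels //.
by case: (0 < e <= n).
Qed.

Definition Fprime (n : nat) : bouquet := Bouquet (Fprime_rotationP n).

Lemma edges_Fprime n e : 1 < n -> (e \in edges (Fprime n)) = (0 < e <= n).
Proof.
move=> n2; rewrite in_fset /= /unzip1 -map_comp map_id.
by rewrite -has_pred1 has_count count_Fprime_labels //; case: (0 < e <= n).
Qed.

(* The value at 0 is the standard one, so that lucas 2 = 1 + 2 = 3. *)
Fixpoint lucas (k : nat) : nat :=
  match k with
  | 0 => 2
  | 1 => 1
  | (k2.+1 as k1).+1 => lucas k1 + lucas k2
  end.

(* Main.v *)
(** Since all loops are orientable, a boundary component is an alternating walk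
    along gaps of the rotation and sides of ribbons: the side of a ribbon with
    ends at positions [i] and [j] joins the gap before [i] to the gap after [j].
    So a bouquet is a quasi-tree iff every 2-coloring of the gaps compatible with
    the ribbon sides is constant.  In these terms an edge [b] occurring as
    [... b b ...] isolates the gap between its ends, and deleting [a] and [b] from
    [A a B b a b] does not change connectedness.  For F'_n with [n >= 4] this
    shows that a quasi-tree either avoids [n], and is one of F'_{n-1}, or contains
    both [n] and [n-1], and is one of F'_{n-2} together with these two edges. *)

Require Import Defs.
From mathcomp Require Import all_boot.
From mathcomp Require Import finmap zify.

Set Implicit Arguments.
Unset Strict Implicit.
Unset Printing Implicit Defensive.

Local Open Scope fset_scope.
Local Open Scope nat_scope.

(** * Boundary components as colorings of gaps *)

(* Gap [i] precedes position [i]; gaps [0] and [size s] are the same one, cyclically. *)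
Definition gap_coloring (s : seq nat) (c : nat -> bool) : Prop :=
  c (size s) = c 0 /\
  forall i j, i < size s -> j < size s -> i != j ->
    nth 0 s i = nth 0 s j -> c i = c j.+1.

(** Gaps on different boundary components can be separated by a coloring, so this expresses
    connectedness of the boundary. For the empty word only gap [0] remains, matching the single
    circle around the bare vertex disc. *)
Definition one_face (s : seq nat) : Prop :=
  forall c, gap_coloring s c -> forall i, i <= size s -> c i = c 0.

Section BoundaryGaps.

Variable s : seq nat.
Let w := [seq (i, false) | i <- s].

Lemma label_unsigned (i : 'I_(size w)) : label i = nth 0 s i.
Proof.
have lt_is : i < size s by rewrite -(size_map (fun i => (i, false)) s).
by rewrite /label (tnth_nth (0, false)) (nth_map 0).
Qed.

Lemma sign_unsigned (i : 'I_(size w)) : sign i = false.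
Proof.
have lt_is : i < size s by rewrite -(size_map (fun i => (i, false)) s).
by rewrite /sign (tnth_nth (0, false)) (nth_map 0).
Qed.

Lemma boundary_adj_sym : symmetric (@boundary_adj w).
Proof.
move=> x y; rewrite /boundary_adj orbCA; congr [|| _, _ | _].
by rewrite /ribbon_side !sign_unsigned eqxx eq_sym [_.2 == _]eq_sym [label _ == _]eq_sym.
Qed.

Let csym := sym_connect_sym boundary_adj_sym.

(** The initial endpoint of an edge end bounds the gap before it and the final endpoint the gap
    after it, so [x] lies on gap [x.1 + x.2]. A vertex segment stays within one gap, up to the
    cyclic identification, and a ribbon side is an instance of the coloring condition. *)
Lemma boundary_adj_gap c (x y : corner w) :
  gap_coloring s c -> boundary_adj x y -> c (x.1 + x.2) = c (y.1 + y.2).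
Proof.
have sz : size w = size s by rewrite size_map.
have vseg (u v : corner w) : c (size w) = c 0 -> vertex_segment u v ->
    c (u.1 + u.2) = c (v.1 + v.2).
  case: u v => [i a] [j b] c0 /and3P[/= -> /negbTE-> /eqP->] /=.
  rewrite addn1 addn0; have := ltn_ord i; rewrite leq_eqVlt.
  by case/predU1P => [->|lt]; [rewrite modnn | rewrite modn_small].
rewrite /gap_coloring -sz; case=> c0 cP /or3P[/vseg -> //|/vseg-> //|].
case: x y => [i a] [j b] /and3P[/= ne].
rewrite !label_unsigned !sign_unsigned eqxx => /eqP lab.
have lti := ltn_ord i; have ltj := ltn_ord j.
case: a b => [] [] //= _; rewrite ?addn0 ?addn1; last exact: cP.
by rewrite (cP j i) // eq_sym.
Qed.

Lemma boundary_components_one_face :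
  reflect (one_face s) (boundary_components w == 1).
Proof.
have sz : size w = size s by rewrite size_map.
rewrite /boundary_components; have [s0|s_gt0] := posnP (size s).
  rewrite /nilp sz s0 eqxx; left => c _ i.
  by rewrite s0 leqn0 => /eqP ->.
rewrite /nilp sz -leqn0 leqNgt s_gt0 /=.
have w_gt0 : 0 < size w by rewrite sz.
pose x0 : corner w := (Ordinal w_gt0, false).
(* Since adjacency is symmetric, one component means that every corner is reachable from [x0]. *)
have -> : (n_comp (@boundary_adj w) predT == 1) =
    [forall x, connect (@boundary_adj w) x0 x].
  apply/eqP/forallP => [n1 x|conn].
    have /card_le1_eqP roots1 : n_comp (@boundary_adj w) predT <= 1 by rewrite n1.
    by apply/(rootP csym)/roots1; rewrite !inE; apply/andP; split=> //; apply: (roots_root csym).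
  rewrite -(n_comp_connect csym x0); apply: eq_n_comp_r => x.
  by rewrite inE; apply/esym/conn.
apply: (iffP forallP) => [conn c cP i le_is|face x].
  have inv x : connect (@boundary_adj w) x0 x -> c (x.1 + x.2) = c 0.
    case/connectP => p; elim/last_ind: p x => [|p y IH] x /=; first by move=> _ ->.
    rewrite rcons_path last_rcons => /andP[pth /(boundary_adj_gap cP) adj ->].
    by rewrite -adj; apply: IH.
  move: le_is; rewrite leq_eqVlt => /predU1P[->|lt_is]; first exact: cP.1.
  rewrite -sz in lt_is.
  by rewrite -(inv (Ordinal lt_is, false)) /= ?addn0.
have lt_mod k : k %% size w < size w by rewrite ltn_mod.
pose gap k : corner w := (Ordinal (lt_mod k), false).
(* For the converse, color gaps by reachability from [x0]. Indices are taken modulo [size w], which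
   identifies the last gap with gap [0]. *)
pose c k := connect (@boundary_adj w) x0 (gap k).
have gapE (i : 'I_(size w)) : gap i = (i, false).
  by congr pair; apply: val_inj; rewrite /= modn_small.
have gapS (i : 'I_(size w)) : connect (@boundary_adj w) (i, true) (gap i.+1).
  apply/connect1/or3P/Or31/and3P; split=> //.
  by apply/eqP/val_inj.
have gap0 : gap 0 = x0 by congr pair; apply: val_inj; rewrite /= mod0n.
have cP : gap_coloring s c.
  split.
    by congr connect; congr pair; apply: val_inj; rewrite /= -sz modnn mod0n.
  move=> i j; rewrite -sz => lti ltj ne lab; rewrite /c.
  apply: (same_connect_r csym); rewrite -[i]/(val (Ordinal lti)) gapE.
  apply: connect_trans (gapS (Ordinal ltj)); apply/connect1/or3P/Or33/and3P.
  by rewrite !label_unsigned !sign_unsigned lab /= eqxx; split.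
have c1 i : i <= size s -> c i.
  by move=> le_is; rewrite (face _ cP) // /c gap0 connect0.
case: x => i [].
  rewrite csym; apply: connect_trans (gapS i) _; rewrite csym.
  by apply: c1; rewrite -sz.
by rewrite -gapE; apply: c1; rewrite -sz ltnW.
Qed.

End BoundaryGaps.

(** * Two local moves on words: isolated gaps and deletion of two edges *)

Lemma not_one_face_isolated b (A C : seq nat) :
  b \notin A -> b \notin C -> ~ one_face (A ++ [:: b, b & C]).
Proof.
move=> bA bC face.
(* The coloring singles out the gap between the two copies of [b]. The only ribbon side meeting this
   gap joins it to itself. *)
have cP : gap_coloring (A ++ [:: b, b & C]) (fun k => k == (size A).+1).
  split=> [|i j]; rewrite size_cat /=; first by lia.
  have nthb k : k < size A + (size C).+2 -> nth 0 (A ++ [:: b, b & C]) k = b ->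
      k = size A \/ k = (size A).+1.
    move=> ltk; rewrite nth_cat; case: ltnP => [ltkA kb|leAk].
      by case/negP: bA; rewrite -kb mem_nth.
    case: (k - size A) (subnKC leAk) ltk => [|[|m]] <- /=; [by left; rewrite addn0 | by right; rewrite addn1 |].
    move=> ltk kb; case/negP: bC; rewrite -kb; apply: mem_nth.
    by move: ltk; rewrite ltn_add2l !ltnS.
  have nthA : nth 0 (A ++ [:: b, b & C]) (size A) = b by rewrite nth_cat ltnn subnn.
  have nthA1 : nth 0 (A ++ [:: b, b & C]) (size A).+1 = b.
    by rewrite nth_cat ltnNge leqnSn /= subSnn.
  move=> lti ltj ne eqij.
  have [ei|nei] := eqVneq i (size A).+1.
    by have := nthb j ltj; rewrite -eqij ei nthA1 => /(_ erefl); lia.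
  have [ej|nej] := eqVneq j (size A).
    by have := nthb i lti; rewrite eqij ej nthA => /(_ erefl); lia.
  by lia.
have := face _ cP (size A).+1; rewrite size_cat /= eqxx; lia.
Qed.

(* Transports a coloring of the gaps of [A ++ B] to [A ++ a :: B ++ [:: b; a; b]],
   where [p] and [q] are the sizes of [A] and [B]. *)
Definition insert_gaps (c : nat -> bool) (p q k : nat) : bool :=
  if k <= p then c k else if k <= p + q + 1 then c k.-1
  else if k <= p + q + 3 then c p else c 0.

(** Here [k'] is the position in the long word of the [k]-th letter of [A ++ B]; the gaps on both
    sides of that letter keep their colors. *)
Lemma insert_gaps_old c p q k : k < p + q ->
  let k' := if k < p then k else k.+1 in
  insert_gaps c p q k' = c k /\ insert_gaps c p q k'.+1 = c k.+1.
Proof.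
rewrite /insert_gaps /= => ltk; split; case: (ltnP k p) => ?;
  by repeat case: ifP => ?; congr c; lia.
Qed.

Lemma insert_gaps_new c p q (d := insert_gaps c p q) :
  [/\ d p = c p, d p.+1 = c p & [/\ d (p + q + 1) = c (p + q),
      d (p + q + 2) = c p, d (p + q + 3) = c p & d (p + q + 4) = c 0]].
Proof.
by rewrite /d /insert_gaps; split; [| | split];
  repeat case: ifP => ?; congr c; lia.
Qed.

(** The sides of [a] and [b] force gaps [p], [p + 1], [p + q + 2] and [p + q + 3] of the long word
    to share a color, and gap [p + q + 1] to have the color of the last gap, that is, of gap [0].
    Hence colorings of the two words correspond, with the same colors occurring. *)
Lemma one_face_pendant a b (A B : seq nat) :
  a != b -> a \notin A ++ B -> b \notin A ++ B ->
  one_face (A ++ a :: B ++ [:: b; a; b]) <-> one_face (A ++ B).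
Proof.
move=> ab aAB bAB; set W := A ++ _.
set p := size A; set q := size B.
have szW : size W = p + q + 4 by rewrite /W size_cat /= size_cat /=; lia.
have szAB : size (A ++ B) = p + q by rewrite size_cat.
have nthlo k : k < p -> nth 0 W k = nth 0 (A ++ B) k.
  by move=> ltk; rewrite !nth_cat ltk.
have nthhi k : p <= k < p + q -> nth 0 W k.+1 = nth 0 (A ++ B) k.
  move=> /andP[lepk ltk]; rewrite !nth_cat -/p.
  have -> : k.+1 < p = false by lia.
  have -> : k < p = false by lia.
  by rewrite subSn //= nth_cat -/q; have -> : k - p < q by lia.
have nth_tail k : nth 0 W (p + q + k.+1) = nth 0 [:: b; a; b] k.
  rewrite nth_cat -/p; have -> : p + q + k.+1 < p = false by lia.
  have -> : p + q + k.+1 - p = (q + k).+1 by lia.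
  rewrite /= nth_cat -/q; have -> : q + k < q = false by lia.
  by rewrite addKn.
have nth_a1 : nth 0 W p = a by rewrite nth_cat ltnn subnn.
have nth_b1 : nth 0 W (p + q + 1) = b by rewrite nth_tail.
have nth_a2 : nth 0 W (p + q + 2) = a by rewrite nth_tail.
have nth_b2 : nth 0 W (p + q + 3) = b by rewrite nth_tail.
have notin k : k < p + q -> nth 0 (A ++ B) k <> a /\ nth 0 (A ++ B) k <> b.
  by move=> ltk; split=> eqk; [case/negP: aAB | case/negP: bAB];
    rewrite -eqk mem_nth ?szAB.
(* Position in [W] of the [k]-th letter of [A ++ B]; the other four positions of [W] are the ends of
   [a] and [b]. *)
pose up k := if k < p then k else k.+1.
have up_inj k l : up k = up l -> k = l.
  by rewrite /up; case: (ltnP k p); case: (ltnP l p); lia.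
have up_lt k : k < p + q -> up k < size W by rewrite /up szW; case: ifP; lia.
have nth_up k : k < p + q -> nth 0 W (up k) = nth 0 (A ++ B) k.
  rewrite /up => ltk; case: (ltnP k p) => [ltkp|lek]; first exact: nthlo.
  by apply: nthhi; rewrite lek.
have [lt_a1 lt_b1 lt_a2 lt_b2] : [/\ p < size W, p + q + 1 < size W,
  p + q + 2 < size W & p + q + 3 < size W] by split; lia.
have posP i : i < size W -> (exists2 k, k < p + q & i = up k) \/
    [\/ i = p, i = p + q + 1, i = p + q + 2 | i = p + q + 3].
  rewrite szW /up => lti; have [ltip|] := ltnP i p.
    by left; exists i; [lia | rewrite ltip].
  rewrite leq_eqVlt => /predU1P[->|ltpi]; first by right; apply: Or41.
  have [leipq|ltpqi] := leqP i (p + q).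
    by left; exists i.-1; [lia | case: ltnP; lia].
  right; have : [|| i == p + q + 1, i == p + q + 2 | i == p + q + 3] by lia.
  by case/or3P => /eqP; [apply: Or42 | apply: Or43 | apply: Or44].
have ba : b <> a by move=> eba; rewrite eba eqxx in ab.
have [ne_a ne_b pq0] : [/\ p != p + q + 2, p + q + 1 != p + q + 3 &
  p + q <= p -> p + q = p] by split; lia.
split=> face c [c0 cP].
  pose d := insert_gaps c p q.
  have d_up k : k < p + q -> d (up k) = c k /\ d (up k).+1 = c k.+1.
    exact: insert_gaps_old.
  have [d_p dS_p [d_1 d_2 d_3 d_4]] := insert_gaps_new c p q.
  rewrite -/d -szAB c0 szAB in d_p dS_p d_1 d_2 d_3 d_4.
  have dS1 : d (p + q + 1).+1 = c p by rewrite -d_2 addn1 addn2.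
  have dS2 : d (p + q + 2).+1 = c p by rewrite -d_3 addn2 addn3.
  have dS3 : d (p + q + 3).+1 = c 0 by rewrite -d_4 addn3 addn4.
  have dP : gap_coloring W d.
    split; first by rewrite szW d_4.
    move=> i j /posP[[k ltk ->]|i4] /posP[[l ltl ->]|j4].
    + move=> ne; rewrite !nth_up // => eqkl.
      rewrite (d_up k ltk).1 (d_up l ltl).2; apply: cP => //; rewrite ?szAB //.
      by apply: contraNneq ne => ->.
    + have [na nb] := notin k ltk; move=> _; rewrite nth_up // => eqk.
      by case: j4 eqk => ->; rewrite ?nth_a1 ?nth_a2 ?nth_b1 ?nth_b2;
        first [move/na | move/nb].
    + have [na nb] := notin l ltl; move=> _; rewrite nth_up // => /esym eqk.
      by case: i4 eqk => ->; rewrite ?nth_a1 ?nth_a2 ?nth_b1 ?nth_b2;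
        first [move/na | move/nb].
    + move/eqP; case: i4 => ->; case: j4 => -> // _;
        rewrite ?nth_a1 ?nth_a2 ?nth_b1 ?nth_b2 => eab;
        by [rewrite ?d_p ?dS_p ?d_1 ?d_2 ?d_3 ?dS1 ?dS2 ?dS3 | case: ba].
  move=> k; rewrite szAB leq_eqVlt => /predU1P[->|ltk]; first by rewrite -szAB c0.
  by rewrite -(d_up k ltk).1 (face d dP) // ltnW ?up_lt.
have c_p : c p = c (p + q + 3).
  by rewrite (cP p (p + q + 2)) ?nth_a1 ?nth_a2 // addn2 addn3.
have c_pS : c p.+1 = c (p + q + 2).
  by rewrite -(cP (p + q + 2) p) ?nth_a1 ?nth_a2 // eq_sym.
have c_1 : c (p + q + 1) = c (p + q + 4).
  by rewrite (cP (p + q + 1) (p + q + 3)) ?nth_b1 ?nth_b2 // addn3 addn4.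
have c_3 : c (p + q + 3) = c (p + q + 2).
  by rewrite (cP (p + q + 3) (p + q + 1)) ?nth_b1 ?nth_b2 // 1?eq_sym // addn1 addn2.
have c_4 : c (p + q + 4) = c 0 by rewrite -szW.
have c_pp : c p.+1 = c p by rewrite c_pS c_p c_3.
(* Gaps [p] and [p + 1] of [W] have equal colors, so they can be merged into gap [p] of [A ++ B]. *)
pose d k := if k <= p then c k else c k.+1.
have d_up k : d k = c (up k) /\ d k.+1 = c (up k).+1.
  by rewrite /d /up; split; case: (ltngtP k p) => // ->; rewrite c_pp.
have d0 : d 0 = c 0 by rewrite /d.
have d_end : d (p + q) = c 0.
  (* If [B] is empty, the last gap of [A ++ B] is the merged gap [p], whence the use of [c_pp]. *)
  by rewrite -c_4 -c_1 addn1 /d; case: ifP => // /pq0 ->; rewrite c_pp.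
have dP : gap_coloring (A ++ B) d.
  split; first by rewrite szAB d_end d0.
  move=> i j; rewrite szAB => lti ltj ne eqij.
  rewrite (d_up i).1 (d_up j).2; apply: cP; rewrite ?nth_up ?up_lt //.
  by apply: contraNneq ne => /up_inj ->.
have d_const k : k <= p + q -> d k = c 0.
  by move=> lek; rewrite (face d dP) ?szAB.
move=> i; rewrite leq_eqVlt => /predU1P[-> //|].
case/posP=> [[k ltk ->]|]; first by rewrite -(d_up k).1 d_const // ltnW.
have cp0 : c p = c 0 by rewrite -(d_const p) ?leq_addr // /d leqnn.
by case=> ->; rewrite ?c_1 ?c_4 // -?c_3 -?c_p.
Qed.

(** * The recursion for the quasi-trees of F'_n *)

Lemma Fprime_quasi_treeP n (F : {fset nat}) :
  reflect (one_face [seq i <- Fprime_labels n | i \in F])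
          (quasi_tree (spanning_subgraph (Fprime n) F)).
Proof.
rewrite /quasi_tree /= /restrict_rotation /Fprime_rotation filter_map.
exact: boundary_components_one_face.
Qed.

(** The cut falls where the first end of edge [k.+3] enters. The third word has the form treated by
    [one_face_pendant], with [a = k.+3] and [b = k.+4]. *)
Lemma Fprime_labels_split k : exists A B,
  [/\ Fprime_labels k.+2 = A ++ B,
      Fprime_labels k.+3 = A ++ k.+3 :: B ++ [:: k.+3] &
      Fprime_labels k.+4 = A ++ k.+3 :: B ++ [:: k.+4; k.+3; k.+4]].
Proof.
have labelsE m : Fprime_labels m.+3 =
    [:: 1; 2; 3; 2; 1] ++ flatten [seq [:: i; i.-1] | i <- iota 4 m] ++ [:: m.+3].
  by rewrite /Fprime_labels; have -> : m.+3 - 3 = m by lia.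
have tailS m : flatten [seq [:: i; i.-1] | i <- iota 4 m.+1] =
    flatten [seq [:: i; i.-1] | i <- iota 4 m] ++ [:: m.+4; m.+3].
  by rewrite -{1}[m.+1]addn1 iotaD map_cat flatten_cat.
case: k => [|k]; first by exists [:: 1; 2], [:: 2; 1].
exists ([:: 1; 2; 3; 2; 1] ++ flatten [seq [:: i; i.-1] | i <- iota 4 k]), [:: k.+3].
by split; rewrite labelsE ?tailS -!catA.
Qed.

Definition quasi_trees n : {fset {fset nat}} :=
  [fset F in fpowerset (edges (Fprime n)) | quasi_tree (spanning_subgraph (Fprime n) F)].

Lemma quasi_treesP k (F : {fset nat}) :
  reflect ((forall e, e \in F -> 0 < e <= k.+2) /\
           one_face [seq i <- Fprime_labels k.+2 | i \in F])
          (F \in quasi_trees k.+2).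
Proof.
rewrite !inE /= fpowersetE.
apply: (iffP andP) => [[/fsubsetP sub /Fprime_quasi_treeP face]|[sub face]].
  by split=> // e /sub; rewrite edges_Fprime.
split; last exact/Fprime_quasi_treeP.
by apply/fsubsetP => e /sub; rewrite edges_Fprime.
Qed.

Lemma quasi_trees_rec k : quasi_trees k.+4 =
  quasi_trees k.+3 `|` [fset k.+3 |` (k.+4 |` F) | F in quasi_trees k.+2].
Proof.
have [A [B [E2 E3 E4]]] := Fprime_labels_split k.
have memAB e : e \in A ++ B -> 0 < e <= k.+2.
  rewrite -E2 -has_pred1 has_count count_Fprime_labels //.
  by case: (0 < e <= k.+2).
have notA (P : pred nat) e : k.+2 < e -> e \notin filter P A ++ filter P B.
  move=> lte; rewrite -filter_cat mem_filter negb_and orbC.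
  by apply/orP; left; apply: contraTN lte => /memAB; lia.
(* [A] and [B] carry only labels up to [k.+2], so larger edges do not affect their restrictions. *)
have eqAB (F G : {fset nat}) : (forall e, e <= k.+2 -> (e \in F) = (e \in G)) ->
    [seq i <- A | i \in F] = [seq i <- A | i \in G] /\
    [seq i <- B | i \in F] = [seq i <- B | i \in G].
  move=> eqFG; split; apply: eq_in_filter => e eAB; apply: eqFG;
    by have := memAB e; rewrite mem_cat eAB ?orbT => /(_ isT) /andP[].
apply/fsetP => F; rewrite inE; apply/quasi_treesP/orP.
  case=> sub; rewrite E4 filter_cat /= filter_cat /=.
  case F3: (k.+3 \in F); case F4: (k.+4 \in F).
  (* Both new edges are present: deleting them leaves a quasi-tree of F'_{k+2}. *)
  - rewrite one_face_pendant ?notA //; last by rewrite neq_ltn ltnSn.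
    move=> face; right; apply/imfsetP => /=.
    pose G := F `\ k.+3 `\ k.+4.
    exists G; last first.
      apply/fsetP => e; rewrite !inE.
      have [->|] := eqVneq e k.+3; first by rewrite F3.
      by have [->|] := eqVneq e k.+4; first by rewrite F4.
    apply/quasi_treesP; split.
      move=> e; rewrite !inE => /and3P[ne4 ne3 /sub]; lia.
    have [e le|EA EB] := @eqAB G F; first by rewrite /G !inE; case: (e \in F); lia.
    by rewrite E2 filter_cat EA EB.
  - move=> face; left; apply/quasi_treesP.
    split; last by rewrite E3 filter_cat /= filter_cat /= F3.
    move=> e eF; have := sub e eF.
    have : e != k.+4 by apply: contraFneq F4 => <-.
    lia.
  (* Without [k.+3], the two ends of [k.+4] become adjacent and isolate a gap. *)
  - move=> face; exfalso; move: face; rewrite catA.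
    by apply: not_one_face_isolated => //; apply: notA.
  - move=> face; left; apply/quasi_treesP.
    split; last by rewrite E3 filter_cat /= filter_cat /= F3.
    move=> e eF; have := sub e eF.
    have : e != k.+4 by apply: contraFneq F4 => <-.
    lia.
case=> [/quasi_treesP[sub]|/imfsetP[G /quasi_treesP[sub]]].
  move=> face; split; first by move=> e /sub; lia.
  have F4 : k.+4 \in F = false by apply/negP => /sub; lia.
  by move: face; rewrite E3 E4 !filter_cat /= !filter_cat /= F4.
rewrite E2 filter_cat => face ->; split.
  by move=> e; rewrite !inE => /or3P[/eqP->|/eqP->|/sub]; lia.
have [e le|EA EB] := @eqAB (k.+3 |` (k.+4 |` G)) G.
  by rewrite !inE; case: (e \in G); lia.
rewrite E4 filter_cat /= filter_cat /= EA EB !inE !eqxx orbT /=.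
by rewrite one_face_pendant ?notA // neq_ltn ltnSn.
Qed.

(** The union is disjoint because only its second part has members containing [k.+4]. Adding the two
    edges is injective on sets with labels at most [k.+2]. *)
Lemma card_quasi_trees_rec k :
  #|` quasi_trees k.+4 | = #|` quasi_trees k.+3 | + #|` quasi_trees k.+2 |.
Proof.
rewrite quasi_trees_rec cardfsU.
have -> : quasi_trees k.+3 `&` [fset k.+3 |` (k.+4 |` F) | F in quasi_trees k.+2] = fset0.
  apply/eqP; rewrite -fsubset0; apply/fsubsetP => F; rewrite inE => /andP[].
  move=> /quasi_treesP[sub _] /imfsetP[G _ EF].
  by have := sub k.+4; rewrite EF !inE eqxx orbT => /(_ isT); lia.
rewrite cardfs0 subn0; congr addn; apply: (etrans (card_in_imfset _ _)) => //.
move=> F G /quasi_treesP[subF _] /quasi_treesP[subG _] /fsetP eqFG.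
apply/fsetP => e; have := eqFG e; rewrite !inE.
have [lee|lte] := leqP e k.+2.
  by have -> : (e == k.+3) = false; [lia | have -> : (e == k.+4) = false; [lia |]].
by move=> _; apply/idP/idP => [/subF|/subG]; lia.
Qed.

(** * Base cases and the count *)

Lemma one_face_nil : one_face [::].
Proof. by move=> c _ i; rewrite leqn0 => /eqP ->. Qed.

(** Gaps 1 and 4, the two lying between an end of edge 1 and an end of edge 2, form a boundary
    component of their own. *)
Lemma not_one_face_123213 : ~ one_face [:: 1; 2; 3; 2; 1; 3].
Proof.
move=> face; suff cP : gap_coloring [:: 1; 2; 3; 2; 1; 3] (fun k => k \in [:: 1; 4]).
  by have := face _ cP 1 isT.
by split=> // i j; case: i => [|[|[|[|[|[|i]]]]]] //; case: j => [|[|[|[|[|[|j]]]]]].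
Qed.

Lemma eq_fset_le3 (F G : {fset nat}) :
  (forall e, e \in F -> 0 < e <= 3) -> (forall e, e \in G -> 0 < e <= 3) ->
  (1 \in F) = (1 \in G) -> (2 \in F) = (2 \in G) -> (3 \in F) = (3 \in G) ->
  F = G.
Proof.
move=> subF subG F1 F2 F3; apply/fsetP => -[|[|[|[|e]]]] //;
  by apply/idP/idP => [/subF|/subG].
Qed.

Lemma quasi_trees2 : quasi_trees 2 = [fset fset0].
Proof.
apply/fsetP => F; rewrite inE; apply/quasi_treesP/eqP => [[sub]|->].
  rewrite /=; case F1: (1 \in F); case F2: (2 \in F) => face.
  - by case: (@not_one_face_isolated 2 [:: 1] [:: 1]).
  - by case: (@not_one_face_isolated 1 [::] [::]).
  - by case: (@not_one_face_isolated 2 [::] [::]).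
  - apply/fsetP => e; rewrite inE; apply/negP => eF; have := sub e eF.
    by case: e eF => [|[|[|e]]]; rewrite ?F1 ?F2.
split; first by move=> e; rewrite inE.
by rewrite /=; apply: one_face_nil.
Qed.

(** Edge 3 interlaces with 1 and with 2, so each of these pairs reduces to the empty word. The other
    nonempty proper subsets leave two adjacent equal letters, and the full set has a second boundary
    component. *)
Lemma quasi_trees3 : quasi_trees 3 = [fset fset0; [fset 1; 3]; [fset 2; 3]].
Proof.
have face1 : one_face [:: 1; 3; 1; 3].
  by apply/(@one_face_pendant 1 3 [::] [::]) => //; apply: one_face_nil.
have face2 : one_face [:: 2; 3; 2; 3].
  by apply/(@one_face_pendant 2 3 [::] [::]) => //; apply: one_face_nil.
apply/fsetP => F; apply/quasi_treesP/idP.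
  case=> sub; rewrite !inE /=.
  case F1: (1 \in F); case F2: (2 \in F); case F3: (3 \in F) => face.
  - by case: not_one_face_123213.
  - by case: (@not_one_face_isolated 2 [:: 1] [:: 1]).
  - have -> : F = [fset 1; 3].
      by apply: eq_fset_le3 => // [e|||]; rewrite !inE //; lia.
    by rewrite eqxx orbT.
  - by case: (@not_one_face_isolated 1 [::] [::]).
  - have -> : F = [fset 2; 3].
      by apply: eq_fset_le3 => // [e|||]; rewrite !inE //; lia.
    by rewrite eqxx orbT.
  - by case: (@not_one_face_isolated 2 [::] [::]).
  - by case: (@not_one_face_isolated 3 [::] [::]).
  - have -> : F = fset0 by apply: eq_fset_le3 => // e; rewrite inE.
    by rewrite eqxx.
rewrite !inE -orbA => /or3P[] /eqP ->; (split; first by move=> e; rewrite !inE; lia);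
  rewrite /= ?inE //=; exact: one_face_nil.
Qed.

Theorem theorem5p1 (n : nat) (hn : 2 <= n) : kappa (Fprime n) = lucas (n - 1).
Proof.
case: n hn => [|[|k]] // _; rewrite subn1 /= -/(quasi_trees k.+2).
(* Two consecutive values are carried through the induction, as the Lucas recurrence requires. *)
suff: #|` quasi_trees k.+2 | = lucas k.+1 /\ #|` quasi_trees k.+3 | = lucas k.+2.
  by case.
elim: k => [|k [IH1 IH2]]; last first.
  by split=> //; rewrite card_quasi_trees_rec IH1 IH2.
rewrite quasi_trees2 quasi_trees3 cardfs1; split=> //.
(* The three quasi-trees of F'_3 are distinct: edge 3 tells two of them from the empty set, and edge
   1 tells these two apart. *)
have neq0 (F : {fset nat}) : 3 \in F -> (F == fset0) = false.
  by apply: contraTF => /eqP ->; rewrite inE.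
have neq12 : ([fset 2; 3] == [fset 1; 3] :> {fset nat}) = false.
  by apply/eqP => /fsetP/(_ 1); rewrite !inE.
by rewrite fsetUC cardfsU1 cardfs2 eq_sym !inE neq12 !neq0 ?inE.
Qed.
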